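(* Let $\mathcal C$ be a Cartan scheme of rank three with $I=\{1,2,3\}$ such that $\mathcal R^{\mathrm{re}}(\mathcal C)$ is a finite irreducible root system of type $\mathcal C$. Let $a\in A$ and let $\gamma_1,\gamma_2,\gamma_3\in R^a$. Assume that $\mathrm{Vol}_3(\gamma_1,\gamma_2,\gamma_3)=1$ and that $\gamma_1-\gamma_2,\ \gamma_1-\gamma_3\notin R^a$. Then $\gamma_1+\gamma_2\in R^a$ or $\gamma_1+\gamma_3\in R^a$.
   Context: Notation: $\mathbb N=\{1,2,3,\dots\}$, $\mathbb N_0=\mathbb N\cup\{0\}$. Let $I$ be a non-empty finite set and $\{\alpha_i\mid i\in I\}$ the standard basis of $\mathbb Z^I$ (the $\alpha_i$ are the simple roots). A generalized Cartan matrix is $C=(c_{ij})_{i,j\in I}\in\mathbb Z^{I\times I}$ with $c_{ii}=2$, $c_{jk}\le 0$ for $j\ne k$, and $c_{ij}=0\Rightarrow c_{ji}=0$. A Cartan scheme $\mathcal C=\mathcal C(I,A,(\rho_i)_{i\in I},(C^a)_{a\in A})$ consists of a non-empty set $A$ (the objects), maps $\rho_i:A\to A$ ($i\in I$), and generalized Cartan matrices $C^a=(c^a_{jk})_{j,k\in I}$ ($a\in A$) such that $\rho_i^2=\mathrm{id}$ and $c^a_{ij}=c^{\rho_i(a)}_{ij}$ for all $a\in A$, $i,j\in I$. Its rank is $\#I$. Define $\sigma_i^a\in\mathrm{Aut}(\mathbb Z^I)$ by $\sigma_i^a(\alpha_j)=\alpha_j-c^a_{ij}\alpha_i$ for all $j\in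 I$. The Weyl groupoid $\mathcal W(\mathcal C)$ is the category with object set $A$ whose morphisms are the compositions of the maps $\sigma_i^a$, where $\sigma_i^a$ is regarded as an element of $\mathrm{Hom}(a,\rho_i(a))$; so each $w\in\mathrm{Hom}(a,b)$ is an automorphism of $\mathbb Z^I$. The set of real roots at $a$ is $R^a=\{w(\alpha_j)\mid b\in A,\ w\in\mathrm{Hom}(b,a),\ j\in I\}$, and $R^a_+=R^a\cap\mathbb N_0^I$. Put $m^a_{i,j}=\#(R^a\cap(\mathbb N_0\alpha_i+\mathbb N_0\alpha_j))$. The pair $\mathcal R^{\mathrm{re}}(\mathcal C)=(\mathcal C,(R^a)_{a\in A})$ is called a root system of type $\mathcal C$ if for all $a\in A$ and $i,j\in I$: (R1) $R^a=R^a_+\cup -R^a_+$; (R2) $R^a\cap\mathbb Z\alpha_i=\{\alpha_i,-\alpha_i\}$; (R3) $\sigma_i^a(R^a)=R^{\rho_i(a)}$; (R4) if $i\ne j$ and $m^a_{i,j}$ is finite then $(\rho_i\rho_j)^{m^a_{i,j}}(a)=a$. It is finite if $R^a$ is finite for all $a\in A$. A finite root system $\mathcal R^{\mathrm{re}}(\mathcal C)$ of type $\mathcal C$ is irreducible if and only if the matrix $C^a$ is indecomposable for every $a\in A$ (this may be taken as the definition). For $\beta_1,\beta_2,\beta_3\in\mathbb Z^3$, $\mathrm{Vol}_3(\beta_1,\beta_2,\beta_3)$ is the absolute value of the determinant of the matrix with columns $\beta_1,\beta_2,\beta_3$. *)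

(* Defs.v *)
From mathcomp Require Import all_boot all_order all_algebra.
From mathcomp Require Import boolp classical_sets functions cardinality.

Set Implicit Arguments.
Unset Strict Implicit.
Unset Printing Implicit Defensive.

Import Order.TTheory GRing.Theory Num.Theory.

Local Open Scope ring_scope.
Local Open Scope classical_set_scope.
Local Open Scope card_scope.

Notation rlattice I := {ffun I -> int}.

Section Roots.
Variable I : finType.

Definition simple_root (i : I) : rlattice I := [ffun j => (j == i)%:R].

Definition nonneg_cone : set (rlattice I) := [set v | forall i, 0 <= v i].

Record is_gcm (c : I -> I -> int) : Prop := IsGcm {
  gcm_diag : forall i, c i i = 2;
  gcm_offdiag : forall j k, j != k -> c j k <= 0;
  gcm_zero : forall i j, c i j = 0 -> c j i = 0 }.

Definition indecomposable (c : I -> I -> int) : Prop :=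
  ~ exists J : {set I},
      [/\ exists i, i \in J,
          exists j, j \notin J
        & forall i j, i \in J -> j \notin J -> c i j = 0 /\ c j i = 0].

Record cartan_scheme : Type := CartanScheme {
  obj : Type;
  rho : I -> obj -> obj;
  cartan : obj -> I -> I -> int;
  index_nonempty : inhabited I;
  obj_nonempty : inhabited obj;
  cartan_gcm : forall a, is_gcm (cartan a);
  rho_invol : forall i a, rho i (rho i a) = a;
  cartan_rho : forall a i j, cartan (rho i a) i j = cartan a i j }.

Variable C : cartan_scheme.

(* The linear extension of alpha_j |-> alpha_j - c^a_ij alpha_i. *)
Definition sigma (i : I) (a : obj C) (v : rlattice I) : rlattice I :=
  \sum_(j : I) (simple_root j - simple_root i *~ cartan a i j) *~ v j.

(* [weyl_hom a b w]: [w] is the automorphism of Z^I underlying some element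
   of Hom(a, b). *)
Inductive weyl_hom : obj C -> obj C -> (rlattice I -> rlattice I) -> Prop :=
| weyl_id a : weyl_hom a a id
| weyl_sigma i a : weyl_hom a (rho i a) (sigma i a)
| weyl_comp a b c w w' :
    weyl_hom b c w -> weyl_hom a b w' -> weyl_hom a c (w \o w').

Definition real_roots (a : obj C) : set (rlattice I) :=
  [set v | exists b w j, weyl_hom b a w /\ v = w (simple_root j)].

Definition pos_roots (a : obj C) : set (rlattice I) :=
  real_roots a `&` nonneg_cone.

Definition plane_roots (a : obj C) (i j : I) : set (rlattice I) :=
  real_roots a `&`
  [set v | exists p q : nat, v = simple_root i *+ p + simple_root j *+ q].

(* [plane_roots a i j #= `I_m] says that m^a_ij is finite and equal to m. *)
Record is_root_system : Prop := IsRootSystem {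
  R1 : forall a, real_roots a = pos_roots a `|` -%R @` pos_roots a;
  R2 : forall a i,
    real_roots a `&` [set v | exists k : int, v = simple_root i *~ k]
    = [set simple_root i; - simple_root i];
  R3 : forall i a, sigma i a @` real_roots a = real_roots (rho i a);
  R4 : forall a i j (m : nat), i != j -> plane_roots a i j #= `I_m ->
    iter m (rho i \o rho j) a = a }.

Definition finite_roots : Prop := forall a, finite_set (real_roots a).

Definition irreducible_scheme : Prop := forall a, indecomposable (@cartan C a).

Lemma sigma_is_additive i a : {morph sigma i a : u v / u - v}.
Proof.
move=> u v; rewrite /sigma -sumrB; apply: eq_bigr => j _.
by rewrite !ffunE mulrzBr.
Qed.

Lemma sigma_simple_root i a j :
  sigma i a (simple_root j) = simple_root j - simple_root i *~ cartan a i j.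
Proof.
rewrite /sigma (bigD1 j) //= big1 ?addr0; first by rewrite ffunE eqxx mulr1z.
by move=> k kj; rewrite ffunE (negbTE kj) mulr0z.
Qed.

End Roots.

Definition Vol3 (b1 b2 b3 : rlattice 'I_3) : int :=
  `|\det (\matrix_(i < 3, j < 3) (nth 0 [:: b1; b2; b3] j) i)|.

(* Main.v *)
(** Let gamma_1, gamma_2 be roots of a plane whose lattice points they span. If
    gamma_1 - gamma_2 is not a root, then a chamber chosen for a suitable
    lexicographic order has both among its simple roots. So, working at another
    object, gamma_1 = alpha_i and gamma_2 = alpha_j, and by the volume condition
    gamma_3 = +-(alpha_k + p alpha_j + x alpha_i) with p, x >= 0.  If
    gamma_1 +- gamma_2 and gamma_1 - gamma_3 are not roots, then c_ij = 0, so
    c_ik <> 0 by irreducibility. Root strings are unbroken, whence x = 0, and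
    sigma_j yields p <= d := - c_jk. Both alpha_i + alpha_k and its image
    alpha_i + alpha_k + d alpha_j under sigma_j are roots, hence so is
    alpha_i + alpha_k + p alpha_j = gamma_1 + gamma_3. *)
Require Import Defs.
From HB Require Import structures.
From mathcomp Require Import all_boot all_order all_algebra.
From mathcomp Require Import boolp classical_sets functions cardinality.
From mathcomp Require Import zify ring.

Set Implicit Arguments.
Unset Strict Implicit.
Unset Printing Implicit Defensive.

Import Order.TTheory GRing.Theory Num.Theory.
Local Open Scope ring_scope.
Local Open Scope classical_set_scope.

(** * Preliminaries on additive maps and counting *)

(** Gives access to the [raddf] lemmas for a map, such as a morphism of the Weyl groupoid, whose
    additivity is only a proposition. *)
Lemma zmod_morphism_bundle (U V : zmodType) (f : U -> V) :
  zmod_morphism f -> exists g : {additive U -> V}, f = g.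
Proof.
move=> fB; pose fP := GRing.isZmodMorphism.Build U V f fB.
by exists (HB.pack f fP : {additive U -> V}).
Qed.

Lemma count_lt (T : eqType) (s : seq T) (p q : pred T) (x : T) :
  {in s, forall y, p y -> q y} -> x \in s -> q x -> ~~ p x ->
  (count p s < count q s)%N.
Proof.
move=> pq xs qx px; rewrite -!size_filter.
have -> : [seq y <- s | p y] = [seq y <- [seq y <- s | q y] | p y].
  rewrite -filter_predI; apply: eq_in_filter => y /pq /=.
  by case: (p y) => //= ->.
rewrite size_filter ltn_neqAle count_size andbT -all_count.
by apply/negP => /allP /(_ x); rewrite mem_filter qx xs (negbTE px) => /(_ isT).
Qed.

(** * Simple reflections and morphisms of the Weyl groupoid *)

Section WeylGroupoid.
Context {I : finType} {C : cartan_scheme I}.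
Implicit Types (a b : obj C) (i j k : I) (v x y : rlattice I) (n : int).

Lemma rlatticeMzE v n i : (v *~ n) i = v i * n.
Proof. by rewrite ffunMzE mulrzz. Qed.

Lemma rlattice_sum v : v = \sum_i simple_root i *~ v i.
Proof.
apply/ffunP => k; rewrite sum_ffunE (bigD1 k) //= big1 ?addr0 => [|j jk].
  by rewrite rlatticeMzE ffunE eqxx mul1r.
by rewrite rlatticeMzE ffunE eq_sym (negbTE jk) mul0r.
Qed.

Lemma sigmaE i a v :
  sigma i a v = v - simple_root i *~ (\sum_j cartan a i j * v j).
Proof.
rewrite {2}(rlattice_sum v) mulrz_sumr -sumrB; apply: eq_bigr => j _.
by rewrite mulrzBl mulrzA.
Qed.

Lemma sigma_coord i a v k : k != i -> sigma i a v k = v k.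
Proof.
by move=> ki; rewrite sigmaE !ffunE rlatticeMzE ffunE (negbTE ki) mul0r subr0.
Qed.

Lemma sigma_self i a : sigma i a (simple_root i) = - simple_root i.
Proof.
rewrite sigma_simple_root (gcm_diag (cartan_gcm _)) (_ : 2 = 1 + 1) //.
by rewrite mulrzDr mulr1z opprD addrA subrr sub0r.
Qed.

(** The i-th rows of the Cartan matrices at a and rho_i(a) agree, and since c_ii = 2 the linear form
    they define changes sign under sigma_i. *)
Lemma sigmaK i a : cancel (sigma i a) (sigma i (rho i a)).
Proof.
move=> v; rewrite [LHS]sigmaE.
have -> : \sum_j cartan (rho i a) i j * sigma i a v j
    = - \sum_j cartan a i j * v j.
  set l := \sum_j cartan a i j * v j.
  under eq_bigr => j _ do
    rewrite cartan_rho sigmaE !ffunE rlatticeMzE ffunE -/l mulrBr mulrA.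
  rewrite sumrB -/l -mulr_suml (bigD1 i) //= big1 => [|j ji]; last first.
    by rewrite (negbTE ji) mulr0.
  by rewrite eqxx (gcm_diag (cartan_gcm a)); lia.
by rewrite sigmaE mulrNz opprK subrK.
Qed.

Lemma weyl_sigma_inv i a : weyl_hom (rho i a) a (sigma i (rho i a)).
Proof. by have := weyl_sigma i (rho i a); rewrite rho_invol. Qed.

Lemma weyl_additive a b w : weyl_hom a b w -> zmod_morphism w.
Proof.
elim=> {a b w} [a|i a|a b c w w' _ IH _ IH'] x y //=.
  exact: sigma_is_additive.
by rewrite IH' IH.
Qed.

Lemma weyl_inv a b w : weyl_hom a b w ->
  exists w', [/\ weyl_hom b a w', cancel w w' & cancel w' w].
Proof.
elim=> {a b w} [a|i a|a b c w w' _ [v [hv wv vw]] _ [v' [hv' wv' vw']]].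
- by exists id; split=> //; apply: weyl_id.
- exists (sigma i (rho i a)); split; first exact: weyl_sigma_inv.
    exact: sigmaK.
  by move=> v; have := sigmaK i (rho i a) v; rewrite rho_invol.
- exists (v' \o v); split; first exact: weyl_comp hv' hv.
    exact: can_comp.
  exact: can_comp.
Qed.

Lemma weyl_sum a b w v : weyl_hom a b w ->
  w v = \sum_i w (simple_root i) *~ v i.
Proof.
move=> /weyl_additive /zmod_morphism_bundle[f ->].
rewrite [in LHS](rlattice_sum v) raddf_sum; apply: eq_bigr => i _.
by rewrite raddfMz.
Qed.

Lemma real_roots_weyl a b w v :
  weyl_hom a b w -> real_roots a v -> real_roots b (w v).
Proof.
move=> hw [c [w' [j [hw' ->]]]]; exists c, (w \o w'), j; split=> //.
exact: weyl_comp hw hw'.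
Qed.

Lemma real_roots_simple a i : real_roots a (simple_root i).
Proof. by exists a, id, i; split=> //; apply: weyl_id. Qed.

(** * Signs of real roots and the choice of a chamber *)

Hypothesis hroot : is_root_system C.

Lemma real_root_sign a v :
  real_roots a v -> nonneg_cone v \/ nonneg_cone (- v).
Proof.
rewrite (R1 hroot) => -[[_]|[u [_ hu] <-]]; first by left.
by right; rewrite opprK.
Qed.

Lemma real_rootsN a v : real_roots a v -> real_roots a (- v).
Proof.
rewrite (R1 hroot) => -[hv|[u hu <-]]; first by right; exists v.
by left; rewrite opprK.
Qed.

Lemma real_root_multiple a i n :
  real_roots a (simple_root i *~ n) -> n = 1 \/ n = -1.
Proof.
move=> hn.
have : (real_roots a `&` [set v | exists k : int, v = simple_root i *~ k])
    (simple_root i *~ n) by split=> //; exists n.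
rewrite (R2 hroot) => -[|] /ffunP/(_ i); rewrite rlatticeMzE !ffunE eqxx.
  by left; lia.
by right; lia.
Qed.

(** By (R2) a positive root other than alpha_i has a positive coordinate at some j != i. As sigma_i
    leaves it unchanged, (R1) makes the whole image nonnegative. *)
Lemma sigma_nonneg a i v : real_roots a v -> nonneg_cone v ->
  v = simple_root i \/ nonneg_cone (sigma i a v).
Proof.
move=> hv v0; have [->|/eqP vi] := pselect (v = simple_root i); first by left.
right; have [j ji vj] : exists2 j, j != i & v j != 0.
  apply: contrapT => H; have vE : v = simple_root i *~ v i.
    apply/ffunP => k; rewrite rlatticeMzE ffunE.
    have [->|ki] := eqVneq k i; first by rewrite mul1r.
    rewrite mul0r; apply/eqP; apply: contrapT => /negP vk.
    by apply: H; exists k.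
  have hvi : real_roots a (simple_root i *~ v i) by rewrite -vE.
  have := v0 i; have [v1|->//] := real_root_multiple hvi.
  by move: vi; rewrite vE v1 mulr1z eqxx.
have [//|sv] := real_root_sign (real_roots_weyl (weyl_sigma i a) hv).
have := sv j; rewrite ffunE sigma_coord //.
by have := v0 j; move: vj; lia.
Qed.

(* Crossing a wall whose simple root is not positive for the given order
   decreases the number of inverted roots. *)
Lemma exists_chamber a (pos : rlattice I -> Prop) :
  finite_set (real_roots a) ->
  (forall x y, pos x -> pos y -> pos (x + y)) ->
  (forall x, x <> 0 -> pos x \/ pos (- x)) -> ~ pos 0 ->
  exists b w, weyl_hom b a w /\ forall i, pos (w (simple_root i)).
Proof.
move=> /finite_seqP[s sE] posD pos_total pos0.
have mem_s v : real_roots a v -> v \in s by rewrite sE.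
(* Positive for the order, but negative with respect to the base w(alpha_i). *)
pose inverted (w : rlattice I -> rlattice I) v :=
  `[< pos v /\ exists2 u : rlattice I, nonneg_cone u & v = - w u >].
suff H (m : nat) b w : weyl_hom b a w -> (count (inverted w) s < m)%N ->
    exists b w, weyl_hom b a w /\ forall i, pos (w (simple_root i)).
  exact: H (weyl_id a) (ltnSn _).
elim: m b w => // m IH b w hw ltm.
have [?|/existsNP[i npos]] := pselect (forall i, pos (w (simple_root i))).
  by exists b, w.
have [w' [hw' ww' w'w]] := weyl_inv hw.
have hwi := weyl_comp hw (weyl_sigma_inv i b).
have [f fE] := zmod_morphism_bundle (weyl_additive hw).
have posi : pos (- w (simple_root i)).
  case: (pos_total (w (simple_root i))) => // /(congr1 w').
  have w0 : w 0 = 0 by rewrite fE raddf0.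
  rewrite ww' -{1}w0 ww' => /ffunP/(_ i); rewrite !ffunE eqxx; lia.
apply: (IH _ _ hwi); rewrite -ltnS; apply: leq_trans ltm; rewrite ltnS.
(* No inversion is gained, and - w(alpha_i) is lost: it is the image of alpha_i under the new
   morphism. *)
apply: (@count_lt _ _ _ _ (- w (simple_root i))).
- move=> v vs /asboolP[pv [u u0 vE]]; apply/asboolP; split=> //.
  have hu : real_roots (rho i b) u.
    have /real_rootsN : real_roots a v by rewrite sE.
    rewrite vE opprK => hwu.
    have [t [ht tK _]] := weyl_inv hwi.
    by rewrite -(tK u); apply: real_roots_weyl ht hwu.
  (* If u = alpha_i, then v = w(alpha_i), which is not positive for the order. *)
  have [uE|su] := sigma_nonneg i hu u0; last by exists (sigma i (rho i b) u).
  by case: npos; move: pv; rewrite vE uE /= sigma_self fE raddfN opprK.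
- exact/mem_s/real_rootsN/(real_roots_weyl hw)/real_roots_simple.
- by apply/asboolP; split=> //; exists (simple_root i) => // j; rewrite ffunE.
- apply/asboolP => -[_ [u u0 /oppr_inj /=]] /(can_inj ww') uE.
  have := u0 i; have /(congr1 (sigma i b)) := uE.
  have := sigmaK i (rho i b) u; rewrite rho_invol => ->.
  rewrite sigma_self => <-; by rewrite !ffunE eqxx.
Qed.

(** * Roots in a plane and root strings *)

Lemma nonneg_simple v : nonneg_cone v -> v <> 0 -> \sum_i v i <= 1 ->
  exists i, v = simple_root i.
Proof.
move=> v0 vn0 le1; have [i vi] : exists i, v i != 0.
  apply: contrapT => /forallNP H; apply: vn0; apply/ffunP => i.
  by rewrite ffunE; apply/eqP; apply: contrapT => /negP /H.
move: le1; rewrite (bigD1 i) //= => le1.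
have S0 : 0 <= \sum_(j | j != i) v j by apply: sumr_ge0 => j _; apply: v0.
have vi0 := v0 i.
have [vi1 sum0] : v i = 1 /\ \sum_(j | j != i) v j = 0.
  by move: vi vi0 S0 le1; move: (\sum_(j | _) _) (v i) => p q; lia.
exists i; apply/ffunP => k; rewrite ffunE; have [->//|ki] := eqVneq k i.
exact: (psumr_eq0P (fun j _ => v0 j) sum0).
Qed.

(* [u, v] is a basis of the lattice of integral points of a plane: [f] and [g]
   are its coordinates and [h] cuts out the plane. *)
Definition plane_basis u v : Prop :=
  exists f g h : {additive rlattice I -> int},
    [/\ [/\ f u = 1, g u = 0 & h u = 0], [/\ f v = 0, g v = 1 & h v = 0]
      & forall x, h x = 0 -> x = u *~ f x + v *~ g x].

(* The chamber is taken for the lexicographic order given by the plane, then by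
   a functional that is 1 on u and -v: only a multiple of u + v could be a
   root between u and -v. *)
Lemma simple_pair a u v :
  finite_set (real_roots a) -> real_roots a u -> real_roots a v ->
  plane_basis u v -> ~ real_roots a (u + v) ->
  exists b w i j, [/\ weyl_hom b a w, i != j,
    w (simple_root i) = u & w (simple_root j) = - v].
Proof.
move=> fin hu hv [f [g [h [[fu gu hu0] [fv gv hv0] uvE]]]] huv.
pose F x := f x - g x.
(* The last comparison only concerns multiples of u + v, where [h] and [F] both vanish. *)
pose pos x := 0 < h x \/ h x = 0 /\ (0 < F x \/ F x = 0 /\ 0 < f x).
have [|x xn0||b [w [hw wpos]]] := @exists_chamber a pos fin.
- by move=> x y; rewrite /pos /F !raddfD /=; lia.
- have : ~ (h x = 0 /\ f x = 0 /\ g x = 0).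
    move=> [hx0 [fx0 gx0]]; apply: xn0.
    by rewrite (uvE _ hx0) fx0 gx0 !mulr0z addr0.
  rewrite /pos /F !raddfN /=; move: (h x) (f x) (g x) => p q r; clear; lia.
- by rewrite /pos /F !raddf0; lia.
have [w' [hw' ww' w'w]] := weyl_inv hw.
have [t tE] := zmod_morphism_bundle (weyl_additive hw').
have [r rE] := zmod_morphism_bundle (weyl_additive hw).
have wF (k : {additive rlattice I -> int}) y :
    k (w y) = \sum_i k (w (simple_root i)) * y i.
  rewrite (weyl_sum y hw) raddf_sum; apply: eq_bigr => i _.
  by rewrite raddfMz /= mulrzz.
have h_ge0 i : 0 <= h (w (simple_root i)) by have := wpos i; rewrite /pos; lia.
(* Otherwise w(alpha_i) is a positive multiple of u + v. It is primitive, so it equals u + v, which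
   is not a root. *)
have F_gt0 i : h (w (simple_root i)) = 0 -> 0 < F (w (simple_root i)).
  move=> hi0; have := wpos i; rewrite /pos hi0 ltxx => -[//|[_ [//|[Fi0 fi]]]].
  have wiE : w (simple_root i) = (u + v) *~ f (w (simple_root i)).
    rewrite mulrzDl {1}(uvE _ hi0); congr (_ + _ *~ _).
    by move: Fi0; rewrite /F; lia.
  have := congr1 (fun x => w' x i) wiE.
  rewrite ww' tE raddfMz /= rlatticeMzE ffunE eqxx -tE mulr1n => E.
  have f1 : f (w (simple_root i)) = 1.
    by move: fi E; move: (f _) (w' _ i) => p q; clear=> p0 pq; have : 0 < q; nia.
  case: huv; move: wiE; rewrite f1 mulr1z => <-.
  exact: real_roots_weyl hw (real_roots_simple b i).
(* As [h] is nonnegative on the base, y is supported on those alpha_i whose image lies in the plane,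
   and there [F] is at least 1. *)
have F_ge y : nonneg_cone y -> h (w y) = 0 -> \sum_i y i <= F (w y).
  move=> y0; rewrite /F !wF -sumrB => hy; apply: ler_sum => i _.
  rewrite -mulrBl; have yi0 := y0 i.
  have /eqP : h (w (simple_root i)) * y i = 0.
    by apply: (psumr_eq0P _ hy) => // j _; apply: mulr_ge0.
  rewrite mulf_eq0 => /orP[/eqP/F_gt0|/eqP ->]; last by rewrite mulr0.
  by rewrite /F; nia.
(* In the plane [F] bounds the height of a positive root, so the value 1 forces a simple root; on
   negative roots [F] is at most 0. *)
have simpleP x : real_roots a x -> h x = 0 -> F x = 1 ->
    exists i, w (simple_root i) = x.
  move=> hx hx0 Fx.
  have [y yE] : exists y, y = w' x by exists (w' x).
  have xE : x = w y by rewrite yE w'w.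
  have [y0|y0] := real_root_sign (real_roots_weyl hw' hx); rewrite -yE in y0.
  - have [i iE] : exists i, y = simple_root i.
      apply: nonneg_simple => // [y00|].
        by move: Fx; rewrite /F !(xE, wF) y00 !big1 // => i _; rewrite ffunE mulr0.
      by rewrite -Fx xE; apply: F_ge => //; rewrite -xE.
    by exists i; rewrite -iE.
  - have : 0 <= F (w (- y)).
      apply: le_trans (F_ge _ y0 _); first exact: sumr_ge0.
      by rewrite rE raddfN raddfN /= -rE -xE hx0 oppr0.
    rewrite rE raddfN /= -rE -xE /F !raddfN /=.
    by move: Fx; rewrite /F; move: (f x) (g x) => p q; lia.
have [i iE] : exists i, w (simple_root i) = u.
  by apply: simpleP => //; rewrite /F fu gu subr0.
have [j jE] : exists j, w (simple_root j) = - v.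
  by apply: simpleP; rewrite ?/F ?raddfN /= ?fv ?gv ?hv0 //; apply: real_rootsN.
exists b, w, i, j; split=> //; apply/eqP => ij.
by move: jE; rewrite -ij iE => /(congr1 f); rewrite raddfN /= fu fv.
Qed.

(** If u + v is not a root, some chamber has u and -v as simple roots, where m u + n v has
    coordinates of both signs, against (R1). *)
Lemma sum_root a u v m n :
  finite_set (real_roots a) -> real_roots a u -> real_roots a v ->
  plane_basis u v -> 0 < m -> 0 < n -> real_roots a (u *~ m + v *~ n) ->
  real_roots a (u + v).
Proof.
move=> fin hu hv huv m0 n0 hmn; apply: contrapT => Nuv.
have [b [w [i [j [hw ij iE jE]]]]] := simple_pair fin hu hv huv Nuv.
have [w' [hw' ww' w'w]] := weyl_inv hw.
have := real_root_sign (real_roots_weyl hw' hmn).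
have [t tE] := zmod_morphism_bundle (weyl_additive hw').
have -> : w' (u *~ m + v *~ n) = simple_root i *~ m - simple_root j *~ n.
  rewrite -iE -[v]opprK -jE tE raddfD /= !raddfMz /= raddfN /= -tE !ww'.
  by rewrite mulNrz.
case=> [/(_ j)|/(_ i)]; rewrite !ffunE !rlatticeMzE !ffunE !eqxx.
  by rewrite eq_sym (negbTE ij); lia.
by rewrite (negbTE ij); lia.
Qed.

Lemma plane_basisN u v : plane_basis u v -> plane_basis u (- v).
Proof.
move=> [f [g [h [[fu gu hu] [fv gv hv] uvE]]]].
exists f, (g \o -%R : {additive _ -> _}), h; split=> /=.
- by rewrite raddfN gu oppr0.
- by rewrite opprK !raddfN fv gv hv oppr0.
- by move=> x hx; rewrite raddfN mulNrNz; apply: uvE.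
Qed.

Lemma plane_basis_shear u v n : plane_basis u v -> plane_basis (u + v *~ n) v.
Proof.
move=> [f [g [h [[fu gu hu] [fv gv hv] uvE]]]].
have [|g' g'E] := zmod_morphism_bundle (f := fun x => g x - n * f x).
  by move=> x y; rewrite !raddfB /=; ring.
exists f, g', h; rewrite -!g'E !raddfD !raddfMz /= fu gu hu fv gv hv !mulrzz.
split; [split; ring|split; ring|move=> x hx].
by rewrite {1}(uvE _ hx) mulrzDl -mulrzA -addrA -mulrzDr subrKC.
Qed.

(** Descent from n to m in unit steps: u is a positive combination of u + (n - d) v and -v, so
    [sum_root] makes their sum a root. *)
Lemma string_root a u v n m :
  finite_set (real_roots a) -> real_roots a u -> real_roots a v ->
  plane_basis u v -> real_roots a (u + v *~ n) -> 0 <= m <= n ->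
  real_roots a (u + v *~ m).
Proof.
move=> fin hu hv huv hn /andP[m0 mn].
have [d mE] : exists d : nat, m = n - d%:Z by exists (absz (n - m)); lia.
rewrite {m}mE in m0 mn *; elim: d m0 {mn} => [|d IH] dn; first by rewrite subr0.
have /IH hd : 0 <= n - d%:Z by lia.
have -> : u + v *~ (n - d.+1%:Z) = u + v *~ (n - d%:Z) + - v.
  by rewrite -addrA -(mulrN1z v) -mulrzDr; congr (_ + _ *~ _); lia.
apply: (@sum_root _ _ _ 1 (n - d%:Z)) => //.
- exact: real_rootsN.
- exact/plane_basisN/plane_basis_shear.
- by lia.
- by rewrite mulr1z mulNrz addrK.
Qed.

End WeylGroupoid.

(** * Rank three: roots next to a pair of simple roots *)

Section RankThree.
Context {C : cartan_scheme 'I_3}.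
Hypotheses (hroot : is_root_system C) (hfin : finite_roots C)
  (hirr : irreducible_scheme C).
Implicit Types (a b : obj C) (i j k l : 'I_3) (u v x y : rlattice 'I_3).

Lemma third_index i j : i != j -> exists k, [/\ i != k & j != k].
Proof.
case: i j => [[|[|[|//]]] ?] [[|[|[|//]]] ?] // _.
all: by [exists (Ordinal (isT : 0 < 3)%N)|exists (Ordinal (isT : 1 < 3)%N)
        |exists (Ordinal (isT : 2 < 3)%N)].
Qed.

Lemma index_cases i j k l : i != j -> i != k -> j != k ->
  [\/ l = i, l = j | l = k].
Proof.
move=> ij ik jk.
have : [|| l == i, l == j | l == k].
  move: ij ik jk.
  by case: i j k l => [[|[|[|//]]] ?] [[|[|[|//]]] ?] [[|[|[|//]]] ?]
    [[|[|[|//]]] ?].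
by case/or3P => /eqP; [constructor 1|constructor 2|constructor 3].
Qed.

Lemma sum_index (R : nmodType) (F : 'I_3 -> R) i j k :
  i != j -> i != k -> j != k -> \sum_l F l = F i + F j + F k.
Proof.
move=> ij ik jk; have [ji ki kj] : [/\ j != i, k != i & k != j].
  by split; rewrite eq_sym.
rewrite (bigD1 i) // (bigD1 j) // (bigD1 k) ?ki //= big1 ?addr0 ?addrA //.
move=> l /andP[/andP[li lj] lk].
by have [E|E|E] := index_cases l ij ik jk; rewrite E eqxx in li lj lk.
Qed.

(** The coordinates are x_k and x_i, and the plane is x_j = p x_k. The case p = 0 covers two simple
    roots. *)
Lemma plane_basis_simple i j k (p : int) : i != j -> i != k -> j != k ->
  plane_basis (simple_root k + simple_root j *~ p) (simple_root i).
Proof.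
move=> ij ik jk.
have [|f fE] := zmod_morphism_bundle (f := fun x : rlattice 'I_3 => x k).
  by move=> x y; rewrite !ffunE.
have [|g gE] := zmod_morphism_bundle (f := fun x : rlattice 'I_3 => x i).
  by move=> x y; rewrite !ffunE.
have [|h hE] :=
    zmod_morphism_bundle (f := fun x : rlattice 'I_3 => x j - p * x k).
  by move=> x y; rewrite !ffunE; ring.
exists f, g, h; rewrite -!fE -!gE -!hE !ffunE !rlatticeMzE !ffunE !eqxx.
rewrite [k == i]eq_sym [k == j]eq_sym [j == i]eq_sym.
rewrite (negbTE ij) (negbTE ik) (negbTE jk) mulr0n mulr1n.
split; [by split; ring|by split; ring|move=> x /eqP].
rewrite subr_eq0 => /eqP hx.
rewrite {1}[x]rlattice_sum (sum_index _ ij ik jk).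
by rewrite hx mulrzDl mulrzA [LHS]addrC addrA addrAC.
Qed.

(** The string from alpha_j to its reflection alpha_j - c_ij alpha_i has length at least 1. *)
Lemma simple_sum_root b i j : i != j -> cartan b i j != 0 ->
  real_roots b (simple_root j + simple_root i).
Proof.
move=> ij cij; have [k [ik jk]] := third_index ij.
rewrite -[simple_root i]mulr1z.
apply: (@string_root _ _ hroot b _ _ (- cartan b i j)) => //.
- exact: real_roots_simple.
- exact: real_roots_simple.
- rewrite -[simple_root j]addr0 -(mulr0z (simple_root k)).
  by apply: plane_basis_simple; rewrite // eq_sym.
- have := real_roots_weyl (weyl_sigma_inv i b) (real_roots_simple (rho i b) j).
  by rewrite sigma_simple_root cartan_rho mulrNz.
- by have := gcm_offdiag (cartan_gcm b) ij; lia.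
Qed.

(** Otherwise {i} would split off from the Cartan matrix. *)
Lemma indecomposable_neighbor b i j k : i != j -> i != k -> j != k ->
  cartan b i j = 0 -> cartan b i k != 0.
Proof.
move=> ij ik jk cij; apply/eqP => cik; case: (hirr (a := b)).
exists [set i]%SET; split.
- by exists i; rewrite inE.
- by exists j; rewrite inE eq_sym.
- have sym := gcm_zero (cartan_gcm b).
  move=> i' l; rewrite !inE => /eqP -> li.
  by have [E|E|E] := index_cases l ij ik jk; rewrite E ?eqxx // in li *;
    split=> //; apply: sym.
Qed.

(** The theorem after transport, with v standing for whichever of gamma_3 and - gamma_3 has
    coefficient 1 at alpha_k. *)
Lemma simple_adjacent_root b i j k v : i != j -> i != k -> j != k ->
  real_roots b v -> v k = 1 -> ~ real_roots b (simple_root i + simple_root j) ->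
  ~ real_roots b (simple_root i - v) -> real_roots b (simple_root i + v).
Proof.
move=> ij ik jk hv vk Nij Niv.
have root_k u (c : obj C) : real_roots c u -> u k = 1 -> forall l, 0 <= u l.
  move=> hu uk; have [//|/(_ k)] := real_root_sign hroot hu.
  by rewrite ffunE uk.
have v0 := root_k _ _ hv vk.
have cji : cartan b j i = 0.
  by apply: contra_notP Nij => /eqP cji; apply: simple_sum_root; rewrite // eq_sym.
(* Stated for every object because it is needed both at b and at rho_j(b). *)
have neighbor (c : obj C) : cartan c j i = 0 ->
    real_roots c (simple_root k + simple_root i).
  move=> cji0; apply: simple_sum_root => //.
  apply: (indecomposable_neighbor ij ik jk).
  exact: gcm_zero (cartan_gcm c) _ _ cji0.
have vE : v = simple_root k + simple_root j *~ v j + simple_root i *~ v i.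
  rewrite {1}[v]rlattice_sum (sum_index _ ij ik jk) vk mulr1z.
  by rewrite [LHS]addrC addrA addrAC.
have simples l : real_roots b (simple_root l) by apply: real_roots_simple.
pose d := - cartan b j k.
(* The root sigma_j(v) still has coordinate 1 at k, so its j-th coordinate d - v_j is
   nonnegative. *)
have vjd : 0 <= v j <= d.
  rewrite v0 /=.
  have := root_k _ _ (real_roots_weyl (weyl_sigma j b) hv).
  rewrite sigma_coord 1?eq_sym // => /(_ vk j).
  rewrite sigmaE !ffunE rlatticeMzE ffunE eqxx (sum_index _ ij ik jk).
  rewrite cji (gcm_diag (cartan_gcm b)) vk /d.
  by move: (v i) (v j) (cartan b j k) => p q r; rewrite mul0r mul1r; clear; lia.
have hkj : real_roots b (simple_root k + simple_root j *~ v j).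
  apply: (string_root hroot (n := d) (hfin b)) vjd => //.
  - rewrite -[simple_root k]addr0 -(mulr0z (simple_root i)).
    by apply: plane_basis_simple; rewrite // eq_sym.
  - have := real_roots_weyl (weyl_sigma_inv j b) (real_roots_simple (rho j b) k).
    by rewrite sigma_simple_root cartan_rho -mulrNz.
(* If v_i > 0, the string in direction alpha_i that ends at v contains v - alpha_i. *)
have vi0 : v i = 0.
  apply: contra_notP Niv => /eqP vi.
  have : real_roots b (simple_root k + simple_root j *~ v j
      + simple_root i *~ (v i - 1)).
    apply: (string_root hroot (n := v i) (hfin b)) => //.
    - exact: plane_basis_simple.
    - by rewrite -vE.
    - by have := v0 i; lia.
  move/(real_rootsN hroot).
  by rewrite mulrzBr mulr1z addrA -vE opprB.
have -> : simple_root i + v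
    = simple_root k + simple_root i *~ 1 + simple_root j *~ v j.
  by rewrite {1}vE vi0 mulr0z addr0 mulr1z addrCA addrA.
apply: (string_root hroot (n := d) (hfin b)) vjd => //.
- by rewrite mulr1z; apply: neighbor.
- by apply: plane_basis_simple; rewrite // eq_sym.
(* Since c_ji = 0, sigma_j fixes alpha_i and sends alpha_k + alpha_i to the far end of the
   string. *)
- have := real_roots_weyl (weyl_sigma_inv j b) (neighbor (rho j b) _).
  rewrite cartan_rho => /(_ cji).
  have [f fE] := zmod_morphism_bundle (@sigma_is_additive _ _ j (rho j b)).
  rewrite fE raddfD /= -fE !sigma_simple_root !cartan_rho cji mulr0z subr0.
  by rewrite mulr1z -mulrNz addrAC.
Qed.

(** Cramer's rule: each coordinate of x is the determinant with one column replaced by x, times the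
    determinant of the basis, which is 1 or -1 and so its own inverse. *)
Lemma Vol3_dual u v t : Vol3 u v t = 1 ->
  exists f g h : {additive rlattice 'I_3 -> int},
    [/\ [/\ f u = 1, g u = 0 & h u = 0], [/\ f v = 0, g v = 1 & h v = 0],
        h t = 1 & forall x, x = u *~ f x + v *~ g x + t *~ h x].
Proof.
pose c (x : rlattice 'I_3) (m : nat) := x (inord m).
have cE x (l : 'I_3) : x l = c x l by rewrite /c inord_val.
pose D x y z : int :=
  c x 0 * (c y 1 * c z 2 - c y 2 * c z 1)
  - c y 0 * (c x 1 * c z 2 - c x 2 * c z 1)
  + c z 0 * (c x 1 * c y 2 - c x 2 * c y 1).
have cB m x y : c (x - y) m = c x m - c y m by rewrite /c !ffunE.
rewrite /Vol3; have -> : \det (\matrix_(i < 3, j < 3) nth 0 [:: u; v; t] j i)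
    = D u v t.
  rewrite (expand_det_row _ ord0) !big_ord_recl big_ord0 /cofactor.
  rewrite !(expand_det_row _ ord0) !big_ord_recl !big_ord0 /cofactor.
  rewrite !det_mx11 !mxE !cE /= /bump /= /D; ring.
move=> D1; have DD : D u v t * D u v t = 1 by lia.
have [|f fE] := zmod_morphism_bundle (f := fun x => D u v t * D x v t).
  by move=> x y; rewrite /D !cB; ring.
have [|g gE] := zmod_morphism_bundle (f := fun x => D u v t * D u x t).
  by move=> x y; rewrite /D !cB; ring.
have [|h hE] := zmod_morphism_bundle (f := fun x => D u v t * D u v x).
  by move=> x y; rewrite /D !cB; ring.
exists f, g, h; rewrite -!fE -!gE -!hE DD.
split; [split=> //|split=> //|by []|]; try by rewrite /D; ring.
move=> x; apply/ffunP => l; rewrite !ffunE !rlatticeMzE -[LHS]mul1r -DD !cE.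
have /= := @index_cases (inord 0) (inord 1) (inord 2) l.
rewrite -!val_eqE /= !inordK // => /(_ isT isT isT).
by case=> ->; rewrite !inordK // /D; ring.
Qed.

End RankThree.

(** * Transport to a chamber with the first two roots simple *)

Theorem proposition3p6 (C : cartan_scheme 'I_3)
    (hroot : is_root_system C) (hfin : finite_roots C)
    (hirr : irreducible_scheme C)
    (a : obj C) (g1 g2 g3 : rlattice 'I_3)
    (h1 : real_roots a g1) (h2 : real_roots a g2) (h3 : real_roots a g3)
    (hvol : Vol3 g1 g2 g3 = 1)
    (h12 : ~ real_roots a (g1 - g2)) (h13 : ~ real_roots a (g1 - g3)) :
  real_roots a (g1 + g2) \/ real_roots a (g1 + g3).
Proof.
have [f [g [h [fghu fghv ht uvtE]]]] := Vol3_dual hvol.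
have uv : plane_basis g1 g2.
  by exists f, g, h; split=> // x hx; rewrite {1}(uvtE x) hx mulr0z addr0.
(* The pair is taken to be gamma_1 and - gamma_2, so that gamma_2 itself becomes simple. *)
have [b [w [i [j [hw ij iE]]]]] := simple_pair hroot (hfin a) h1
  (real_rootsN hroot h2) (plane_basisN uv) h12.
rewrite opprK => jE.
have [k [ik jk]] := third_index ij.
have [w' [hw' ww' w'w]] := weyl_inv hw.
have [t tE] := zmod_morphism_bundle (weyl_additive hw).
pose v := w' g3; have vE : g3 = w v by rewrite w'w.
have hv : real_roots b v := real_roots_weyl hw' h3.
(* [h] vanishes on gamma_1 and gamma_2 and is 1 on gamma_3, so v_k divides 1. *)
have vk : v k = 1 \/ v k = -1.
  have : h (w (simple_root k)) * v k = 1.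
    rewrite -ht vE (weyl_sum v hw) (sum_index _ ij ik jk) iE jE !raddfD !raddfMz /=.
    by have [_ _ ->] := fghu; have [_ _ ->] := fghv; rewrite !mul0rz !add0r mulrzz.
  by move=> /intUnitRing.unitzPl /orP[]/eqP ->; [left|right].
have [//|N12] := pselect (real_roots a (g1 + g2)); [by left|right].
have image y : real_roots b y -> real_roots a (w y) := real_roots_weyl hw.
have Nij : ~ real_roots b (simple_root i + simple_root j).
  by move/image; rewrite tE raddfD -tE iE jE.
have Niv : ~ real_roots b (simple_root i - v).
  by move/image; rewrite tE raddfB -tE iE -vE.
apply: contrapT => N13.
have Niv' : ~ real_roots b (simple_root i + v).
  by move/image; rewrite tE raddfD -tE iE -vE.
case: vk => vk.
  exact: Niv' (simple_adjacent_root hroot hfin hirr ij ik jk hv vk Nij Niv).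
(* For -v the two non-roots alpha_i - v and alpha_i + v exchange roles. *)
apply: Niv; apply: (simple_adjacent_root hroot hfin hirr ij ik jk _ _ Nij).
- exact: real_rootsN.
- by rewrite ffunE vk opprK.
- by rewrite opprK.
Qed.
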